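(* Let $\{x_1,\dots,x_n\}$ be a linearly independent system of vectors in $H$, let $M:=\operatorname{span}\{x_1,\dots,x_n\}$, and let $x\in H$ with $x\notin M^{\perp}$. Then $$d^2(x,M)\le\frac{\|x\|^2\left[\max_{1\le i\le n}\|x_i\|^2+(n-1)\max_{1\le i\ne j\le n}|\langle x_i,x_j\rangle|\right]-\sum_{i=1}^n|\langle x,x_i\rangle|^2}{\max_{1\le i\le n}\|x_i\|^2+(n-1)\max_{1\le i\ne j\le n}|\langle x_i,x_j\rangle|},$$ or, equivalently, $$\Gamma(x_1,\dots,x_n,x)\le\frac{\|x\|^2\left[\max_{1\le i\le n}\|x_i\|^2+(n-1)\max_{1\le i\ne j\le n}|\langle x_i,x_j\rangle|\right]-\sum_{i=1}^n|\langle x,x_i\rangle|^2}{\max_{1\le i\le n}\|x_i\|^2+(n-1)\max_{1\le i\ne j\le n}|\langle x_i,x_j\rangle|}\cdot\Gamma(x_1,\dots,x_n).$$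
   Context: $(H;\langle\cdot,\cdot\rangle)$ is an inner product space over the real or complex number field $\mathbb{K}$, with norm $\|x\|=\langle x,x\rangle^{1/2}$. $M^{\perp}$ is the orthogonal complement of $M$ in $H$, and $d(x,M)=\inf_{y\in M}\|x-y\|$ is the distance from $x$ to $M$. For vectors $y_1,\dots,y_m\in H$, $\Gamma(y_1,\dots,y_m)$ denotes the Gram determinant, i.e. the determinant of the $m\times m$ matrix whose $(i,j)$-entry is $\langle y_i,y_j\rangle$. When $n=1$ the term $(n-1)\max_{1\le i\ne j\le n}|\langle x_i,x_j\rangle|$ is read as $0$. *)

(* Defs.v *)
From HB Require Import structures.
From mathcomp Require Import all_boot all_order all_algebra.
From mathcomp Require Import complex.
From mathcomp Require Import classical_sets reals.

Set Implicit Arguments.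
Unset Strict Implicit.
Unset Printing Implicit Defensive.

Import Order.TTheory GRing.Theory Num.Theory.

Local Open Scope classical_set_scope.
Local Open Scope ring_scope.

(* The scalar field is either R itself or R[i]: results are stated once, for
   [scalars R k] with [k] arbitrary. *)
Variant scalar_kind := RealScalars | ComplexScalars.

Definition scalars (R : realType) (k : scalar_kind) : numFieldType :=
  match k with
  | RealScalars => R : numFieldType
  | ComplexScalars => R[i] : numFieldType
  end.

Definition scalar_conj (R : realType) (k : scalar_kind) :
    scalars R k -> scalars R k :=
  match k with
  | RealScalars => @idfun R
  | ComplexScalars => @Num.conj R[i]
  end.

Definition scalar_of_real (R : realType) (k : scalar_kind) : R -> scalars R k :=
  match k with
  | RealScalars => @idfun R
  | ComplexScalars => @real_complex_def R (Phant R)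
  end.

Definition scalar_Re (R : realType) (k : scalar_kind) : scalars R k -> R :=
  match k with
  | RealScalars => @idfun R
  | ComplexScalars => @complex.Re R
  end.

(* The norm [`|z|] of [z : R[i]] is itself an element of R[i], with zero
   imaginary part; this is the modulus as an element of R. *)
Definition scalar_abs (R : realType) (k : scalar_kind) (z : scalars R k) : R :=
  scalar_Re `|z|.

Section InnerProduct.
Context (R : realType) (k : scalar_kind) (H : lmodType (scalars R k)).
(* A [dot] form is linear in its first argument, Hermitian and positive
   definite; H may have infinite dimension. *)
Context (dot : {dot H for @scalar_conj R k}).

Definition ip_norm (x : H) : R := Num.sqrt (scalar_Re (dot x x)).

Definition ip_dist (x : H) (M : set H) : R := inf [set ip_norm (x - y) | y in M].

Definition orthogonal_complement (M : set H) : set H :=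
  [set x | forall y, M y -> dot x y = 0].

Definition gram_det (m : nat) (y : 'I_m -> H) : scalars R k :=
  \det (\matrix_(i < m, j < m) dot (y i) (y j)).

End InnerProduct.

Section Families.
Context (K : numFieldType) (H : lmodType K) (n : nat) (v : 'I_n -> H).

Definition linearly_independent : Prop :=
  forall c : 'I_n -> K, \sum_(i < n) c i *: v i = 0 -> forall i, c i = 0.

Definition linear_span : set H :=
  [set y | exists c : 'I_n -> K, y = \sum_(i < n) c i *: v i].

(* v_0, ..., v_(n-1), x: the appended vector x has index [ord_max]. *)
Definition append_vector (x : H) (i : 'I_n.+1) : H :=
  if unlift ord_max i is Some j then v j else x.

End Families.

Section Constants.
Context (R : realType) (k : scalar_kind) (H : lmodType (scalars R k)).
Context (dot : {dot H for @scalar_conj R k}) (n : nat) (v : 'I_n -> H).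

(* All the values below are nonnegative, so 0 is a neutral default; a maximum
   over an empty index set (for instance over i <> j when n = 1) is 0. *)
Definition max_sqnorm : R :=
  \big[Num.max/0]_(i < n) ip_norm dot (v i) ^+ 2.

Definition max_offdiag : R :=
  \big[Num.max/0]_(p : 'I_n * 'I_n | p.1 != p.2)
    scalar_abs (dot (v p.1) (v p.2)).

End Constants.

(* Main.v *)
(** Let B be the bracket in the theorem.  By AM-GM the Gram matrix has norm at
    most B, that is, |sum c_i v_i|^2 <= B * sum |c_i|^2.  Hence the vector
    y = B^-1 * sum <x, v_i> v_i of M satisfies |x - y|^2 <= |x|^2 - S / B, with
    S = sum |<x, v_i>|^2, and d(x, M) <= |x - y|.  For the Gram determinants,
    let p be the orthogonal projection of x on M: then
    Gamma(v, x) = |x - p|^2 Gamma(v), and |x - p| <= |x - y|. *)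

Require Import Defs.
From HB Require Import structures.
From mathcomp Require Import all_boot all_order all_algebra.
From mathcomp Require Import complex ring lra.
From mathcomp Require Import classical_sets reals.

Set Implicit Arguments.
Unset Strict Implicit.
Unset Printing Implicit Defensive.

Import Order.TTheory GRing.Theory Num.Theory.

Local Open Scope ring_scope.

(** * Arithmetic common to the real and the complex scalar field *)

Section Scalars.
Context (R : realType) (k : scalar_kind).

Lemma scalar_of_real_is_zmod_morphism : zmod_morphism (@scalar_of_real R k).
Proof. by case: k => // x y; exact: (rmorphB (real_complex R)). Qed.

Lemma scalar_of_real_is_monoid_morphism : monoid_morphism (@scalar_of_real R k).
Proof.
by case: k; split=> // x y; exact: (rmorphM (real_complex R)).
Qed.

HB.instance Definition _ := GRing.isZmodMorphism.Build R (scalars R k)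
  (@scalar_of_real R k) scalar_of_real_is_zmod_morphism.
HB.instance Definition _ := GRing.isMonoidMorphism.Build R (scalars R k)
  (@scalar_of_real R k) scalar_of_real_is_monoid_morphism.

Lemma scalar_conj_is_zmod_morphism : zmod_morphism (@scalar_conj R k).
Proof. by case: k => // x y; exact: (rmorphB (@Num.conj R[i])). Qed.

Lemma scalar_conj_is_monoid_morphism : monoid_morphism (@scalar_conj R k).
Proof.
case: k; first by [].
by split=> [|x y]; [exact: (rmorph1 (@Num.conj R[i]))
  | exact: (rmorphM (@Num.conj R[i]))].
Qed.

HB.instance Definition _ := GRing.isZmodMorphism.Build (scalars R k)
  (scalars R k) (@scalar_conj R k) scalar_conj_is_zmod_morphism.
HB.instance Definition _ := GRing.isMonoidMorphism.Build (scalars R k)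
  (scalars R k) (@scalar_conj R k) scalar_conj_is_monoid_morphism.

(** This lets an inequality between real quantities be proved among the scalars, where the inner
    product takes its values. *)
Lemma scalar_of_real_le : {mono @scalar_of_real R k : a b / a <= b}.
Proof. by case: k => // a b; exact: lecR. Qed.

(** In [R[i]] the order makes every nonnegative element real. *)
Lemma scalar_ReK (z : scalars R k) :
  0 <= z -> scalar_of_real k (scalar_Re z) = z.
Proof.
by case: k z => //= z z_ge0; rewrite RRe_real // ger0_real.
Qed.

Lemma scalar_absK (z : scalars R k) : scalar_of_real k (scalar_abs z) = `|z|.
Proof. exact: scalar_ReK. Qed.

Lemma scalar_abs_ge0 (z : scalars R k) : 0 <= scalar_abs z.
Proof. by rewrite -scalar_of_real_le scalar_absK rmorph0. Qed.

Lemma mul_scalar_conj (z : scalars R k) : z * scalar_conj z = `|z| ^+ 2.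
Proof.
case: k z => z /=; last by rewrite normCK.
by rewrite real_normK ?num_real.
Qed.

Lemma norm_scalar_conj (z : scalars R k) : `|scalar_conj z| = `|z|.
Proof. by case: k z => //= z; rewrite norm_conjC. Qed.

Lemma scalar_conj_of_real (a : R) :
  scalar_conj (scalar_of_real k a) = scalar_of_real k a.
Proof.
by case: k => //=; rewrite conj_Creal //; apply/complex_realP; exists a.
Qed.

End Scalars.

(** * Elementary properties of the inner product and its norm *)

Section InnerProductTheory.
Context (R : realType) (k : scalar_kind) (H : lmodType (scalars R k)).
Context (dot : {dot H for @scalar_conj R k}).
Implicit Types (x y z : H).

Lemma dotC x y : dot x y = scalar_conj (dot y x).
Proof. by rewrite hermC mul1r. Qed.

Lemma dot_ge0 x : 0 <= dot x x.
Proof.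
by have [->|/neq0_dnorm_gt0/ltW] := eqVneq x 0; rewrite ?linear0l.
Qed.

Lemma dot_eq0 x : dot x x = 0 -> x = 0.
Proof.
move=> dxx0; have [//|x_neq0] := eqVneq x 0.
have dxx_gt0 : 0 < dot x x by exact: neq0_dnorm_gt0.
by rewrite dxx0 ltxx in dxx_gt0.
Qed.

Lemma sqr_ip_norm x : scalar_of_real k (ip_norm dot x ^+ 2) = dot x x.
Proof.
rewrite sqr_sqrtr ?scalar_ReK ?dot_ge0 //.
by rewrite -(scalar_of_real_le k) rmorph0 scalar_ReK dot_ge0.
Qed.

Lemma ip_norm_ge0 x : 0 <= ip_norm dot x.
Proof. exact: sqrtr_ge0. Qed.

Lemma dot_suml (n : nat) (c : 'I_n -> scalars R k) (v : 'I_n -> H) y :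
  dot (\sum_i c i *: v i) y = \sum_i c i * dot (v i) y.
Proof. by rewrite linear_sumlz; apply: eq_bigr => i _; rewrite linearZl_LR. Qed.

Lemma dot_sumr (n : nat) (c : 'I_n -> scalars R k) (v : 'I_n -> H) y :
  dot y (\sum_i c i *: v i) = \sum_i scalar_conj (c i) * dot y (v i).
Proof. by rewrite linear_sumr; apply: eq_bigr => i _; rewrite linearZr_LR. Qed.

End InnerProductTheory.

Lemma big_max_le (R : realDomainType) (I : finType) (P : pred I) (F : I -> R)
    (i : I) : P i -> F i <= \big[Num.max/0]_(j | P j) F j.
Proof. by move=> Pi; rewrite (bigD1 i) //= le_max lexx. Qed.

(** * A Bessel-type inequality for families that need not be orthogonal *)

Section Bessel.
Context (R : realType) (k : scalar_kind) (H : lmodType (scalars R k)).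
Context (dot : {dot H for @scalar_conj R k}) (n : nat) (v : 'I_n -> H).

Let bessel_const := max_sqnorm dot v + (n%:R - 1) * max_offdiag dot v.

Lemma scalar_abs_dot_le (i j : 'I_n) :
  scalar_abs (dot (v i) (v j)) <=
    if i == j then max_sqnorm dot v else max_offdiag dot v.
Proof.
have [<-|neq_ij] := eqVneq.
  suff -> : scalar_abs (dot (v i) (v i)) = ip_norm dot (v i) ^+ 2.
    exact: (@big_max_le _ _ xpredT (fun i => ip_norm dot (v i) ^+ 2)).
  apply: (fmorph_inj (@scalar_of_real R k)).
  by rewrite /= scalar_absK sqr_ip_norm ger0_norm // dot_ge0.
exact: (@big_max_le _ _ (fun p => p.1 != p.2)
  (fun p => scalar_abs (dot (v p.1) (v p.2))) (i, j)).
Qed.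

Lemma max_offdiag_ge0 : 0 <= max_offdiag dot v.
Proof.
rewrite /max_offdiag; elim/big_rec: _ => // p a _ a_ge0.
by rewrite le_max a_ge0 orbT.
Qed.

(** A zero vector in the family would satisfy a nontrivial linear relation, so the first vector
    already has positive norm. *)
Lemma max_sqnorm_gt0 : (0 < n)%N -> linearly_independent v ->
  0 < max_sqnorm dot v.
Proof.
case: n v => // m w _ w_free.
suff sqnorm_gt0 : 0 < ip_norm dot (w ord0) ^+ 2.
  apply: lt_le_trans sqnorm_gt0 _.
  exact: (@big_max_le _ _ xpredT (fun i => ip_norm dot (w i) ^+ 2)).
rewrite lt_def sqr_ge0 andbT -(fmorph_eq0 (@scalar_of_real R k)).
rewrite /= sqr_ip_norm; apply/eqP => /dot_eq0 w0_eq0.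
have comb0 : \sum_i (i == ord0)%:R *: w i = 0.
  rewrite (bigD1 ord0) //= w0_eq0 scaler0 add0r.
  by rewrite big1 // => i /negPf ->; rewrite scale0r.
by have /eqP := w_free _ comb0 ord0; rewrite eqxx oner_eq0.
Qed.

(* AM-GM: |c_i| |c_j| <= (|c_i|^2 + |c_j|^2) / 2 on the off-diagonal terms. *)
Lemma sqr_ip_norm_sum_le (c : 'I_n -> scalars R k) :
  ip_norm dot (\sum_i c i *: v i) ^+ 2 <=
    bessel_const * \sum_i scalar_abs (c i) ^+ 2.
Proof.
pose a i := scalar_abs (c i).
have a_ge0 i : 0 <= a i by exact: scalar_abs_ge0.
pose A := max_sqnorm dot v; pose D := max_offdiag dot v.
have D_ge0 : 0 <= D := max_offdiag_ge0.
have le1 : ip_norm dot (\sum_i c i *: v i) ^+ 2 <=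
    \sum_i \sum_j a i * a j * scalar_abs (dot (v i) (v j)).
  (* The inner product of the sum with itself is nonnegative, hence equal to its modulus, and the
     triangle inequality applies to its double-sum expansion. *)
  rewrite -(scalar_of_real_le k) sqr_ip_norm -[leLHS]ger0_norm ?dot_ge0 //.
  rewrite dot_suml (le_trans (ler_norm_sum _ _ _)) // rmorph_sum.
  apply: ler_sum => i _; rewrite dot_sumr mulr_sumr rmorph_sum.
  rewrite (le_trans (ler_norm_sum _ _ _)) //; apply: ler_sum => j _.
  by rewrite !rmorphM /= !scalar_absK !normrM norm_scalar_conj mulrA.
apply: (le_trans le1).
pose q i := a i ^+ 2.
(* The AM-GM term gives [D * q i] on the diagonal too; [A - D] corrects it to [A * q i]. Summing
   over both indices yields [(A - D) + n * D], which is [A + (n - 1) * D], times the sum of the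
   [q i]. *)
apply: (@le_trans _ _
    (\sum_i \sum_j ((i == j)%:R * (A - D) * q i + D / 2 * (q i + q j)))).
  apply: ler_sum => i _; apply: ler_sum => j _.
  apply: (le_trans (ler_wpM2l _ (scalar_abs_dot_le i j))).
    by rewrite mulr_ge0.
  have [<-|_] := eqVneq; first by rewrite /q -/A mulr1n; lra.
  have := mulr_ge0 D_ge0 (sqr_ge0 (a i - a j));
  rewrite /q -/D mulr0n !mul0r add0r; lra.
under eq_bigr => i _.
  rewrite big_split /= (bigD1 i) //= eqxx mul1r big1 ?addr0; last first.
    by move=> j /negPf neq_ji; rewrite eq_sym neq_ji !mul0r.
  rewrite -mulr_sumr big_split /= sumr_const card_ord.
  over.
rewrite big_split /= -!mulr_sumr big_split /= sumr_const card_ord.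
rewrite sumrMnl /bessel_const -/A -/D -[_ *+ n]mulr_natl.
by rewrite le_eqVlt; apply/orP; left; apply/eqP; rewrite /q /a; field.
Qed.

(** With weight t in place of 1/B, the expansion of the square is at most |x|^2 - 2tS + t^2 B S; t =
    1/B minimises this. *)
Lemma sqr_ip_norm_sub_bessel_sum (x : H) : 0 < bessel_const ->
  ip_norm dot (x - \sum_i (dot x (v i) / scalar_of_real k bessel_const) *: v i)
    ^+ 2 <=
  (ip_norm dot x ^+ 2 * bessel_const
     - \sum_i scalar_abs (dot x (v i)) ^+ 2) / bessel_const.
Proof.
set B := bessel_const => B_gt0.
pose S := \sum_i scalar_abs (dot x (v i)) ^+ 2.
set y := \sum_i _ *: v i.
have dyx : dot y x = scalar_of_real k (S / B).
  rewrite dot_suml /S rmorphM rmorph_sum mulr_suml; apply: eq_bigr => i _.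
  rewrite [dot (v i) x]dotC fmorphV rmorphXn /= scalar_absK -mul_scalar_conj.
  by rewrite mulrAC.
have dxy : dot x y = scalar_of_real k (S / B).
  by rewrite dotC dyx scalar_conj_of_real.
have -> : ip_norm dot (x - y) ^+ 2 =
    ip_norm dot x ^+ 2 - 2 * (S / B) + ip_norm dot y ^+ 2.
  apply: (fmorph_inj (@scalar_of_real R k)).
  rewrite rmorphD rmorphB (rmorphM _ 2) rmorph_nat /= !sqr_ip_norm.
  rewrite linearBl !linearBr /= dxy dyx; ring.
have ny : ip_norm dot y ^+ 2 <= S / B.
  apply: (le_trans (sqr_ip_norm_sum_le _)).
  rewrite -/B le_eqVlt; apply/orP; left; apply/eqP.
  rewrite /S mulr_suml mulr_sumr; apply: eq_bigr => i _.
  have -> : scalar_abs (dot x (v i) / scalar_of_real k B) =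
      scalar_abs (dot x (v i)) / B.
    apply: (fmorph_inj (@scalar_of_real R k)).
    rewrite rmorphM fmorphV /= !scalar_absK normrM normfV.
    rewrite [`|scalar_of_real _ B|]ger0_norm //.
    by rewrite -(rmorph0 (@scalar_of_real R k)) scalar_of_real_le ltW.
  by field; rewrite gt_eqF.
rewrite -/S mulrBl mulfK ?gt_eqF //; lra.
Qed.

End Bessel.

(** * Orthogonal projection and Gram determinants *)

Section Gram.
Context (R : realType) (k : scalar_kind) (H : lmodType (scalars R k)).
Context (dot : {dot H for @scalar_conj R k}).

Lemma dot_sum_eq0 (n : nat) (v : 'I_n -> H) (c : 'I_n -> scalars R k) (z : H) :
  (forall j, dot z (v j) = 0) -> dot z (\sum_i c i *: v i) = 0.
Proof.
by move=> zv; rewrite dot_sumr big1 // => i _; rewrite zv mulr0.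
Qed.

(** If a row c is killed by the Gram matrix, the combination of the [v i] with coefficients c is
    orthogonal to every [v j], hence to itself; so it vanishes, and c = 0 by independence. *)
Lemma gram_unitmx (n : nat) (v : 'I_n -> H) : linearly_independent v ->
  \matrix_(i < n, j < n) dot (v i) (v j) \in unitmx.
Proof.
move=> v_free; rewrite -row_free_unit -kermx_eq0; apply/rowV0P => c.
move=> /sub_kermxP cG0; apply/rowP => i; rewrite mxE.
apply: v_free i; apply: dot_eq0; apply: dot_sum_eq0 => j.
have /rowP/(_ j) := cG0; rewrite !mxE => cGj; rewrite dot_suml -[RHS]cGj.
by apply: eq_bigr => i _; rewrite mxE.
Qed.

Lemma orthogonal_projection (n : nat) (v : 'I_n -> H) (x : H) :
  linearly_independent v ->
  exists c, forall j, dot (x - \sum_(i < n) c i *: v i) (v j) = 0.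
Proof.
move=> /gram_unitmx; set G := \matrix_(i, j) _ => G_unit.
(* Orthogonality to all [v j] is the linear system c G = b, solved by inverting G. *)
pose b := \row_j dot x (v j); exists (fun i => (b *m invmx G) 0 i) => j.
rewrite linearBl /= dot_suml; apply/eqP; rewrite subr_eq0; apply/eqP.
have /rowP/(_ j) := mulmxKV G_unit b; rewrite !mxE => <-.
by apply: eq_bigr => i _; rewrite [G i j]mxE.
Qed.

(** Pythagoras: the two residuals differ by a vector of the span, which is orthogonal to the first
    one. *)
Lemma sqr_ip_norm_projection_min (n : nat) (v : 'I_n -> H) (x : H)
    (c e : 'I_n -> scalars R k) :
  (forall j, dot (x - \sum_(i < n) c i *: v i) (v j) = 0) ->
  ip_norm dot (x - \sum_(i < n) c i *: v i) ^+ 2 <=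
    ip_norm dot (x - \sum_(i < n) e i *: v i) ^+ 2.
Proof.
move=> orth; rewrite -(scalar_of_real_le k) !sqr_ip_norm.
set z := x - _ in orth *.
pose w := \sum_i (c i - e i) *: v i.
have -> : x - \sum_(i < n) e i *: v i = z + w.
  rewrite /w; under [in RHS]eq_bigr do rewrite scalerBl.
  by rewrite sumrB addrA subrK.
have zw0 : dot z w = 0 by exact: dot_sum_eq0.
by rewrite (hnormDd zw0) lerDl dot_ge0.
Qed.

(* Subtracting from the last row of the Gram matrix its projection onto the
   other rows leaves a single nonzero entry, in the corner. *)
Lemma gram_det_append_vector (n : nat) (v : 'I_n -> H) (x : H)
    (c : 'I_n -> scalars R k) :
  (forall j, dot (x - \sum_(i < n) c i *: v i) (v j) = 0) ->
  gram_det dot (append_vector v x) =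
    scalar_of_real k (ip_norm dot (x - \sum_(i < n) c i *: v i) ^+ 2)
      * gram_det dot v.
Proof.
set z := x - _ => orth.
pose w := append_vector v x.
have w_lift i : w (lift ord_max i) = v i by rewrite /w /append_vector liftK.
have w_max : w ord_max = x by rewrite /w /append_vector unlift_none.
pose G := \matrix_(i, j) dot (w i) (w j).
(* [L] encodes the row operation: it is lower unitriangular, so [L *m G] has the determinant of [G],
   and its last row turns x into z. *)
pose L : 'M[scalars R k]_n.+1 := \matrix_(i, j)
  if i == ord_max then (if unlift ord_max j is Some l then - c l else 1)
  else (i == j)%:R.
have L_trig : is_trig_mx L.
  apply/is_trig_mxP => i j lt_ij; rewrite mxE.
  have [ieq|_] := eqVneq; last by rewrite (ltn_eqF lt_ij : (i == j) = false).
  by rewrite ieq ltnNge leq_ord in lt_ij.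
have detL : \det L = 1.
  rewrite det_trig // big1 // => i _; rewrite mxE eqxx.
  by case: eqVneq => // ->; rewrite unlift_none.
have LG_max j : (L *m G) ord_max j = dot z (w j).
  rewrite mxE (bigD1_ord ord_max) //= !mxE eqxx unlift_none mul1r w_max.
  rewrite linearBl /= dot_suml -sumrN; congr (_ + _).
  by apply: eq_bigr => i _; rewrite !mxE eqxx liftK w_lift mulNr.
have LG_lift i j : (L *m G) (lift ord_max i) j = dot (v i) (w j).
  rewrite mxE (bigD1 (lift ord_max i)) //= !mxE eqxx w_lift.
  rewrite eq_sym (negPf (neq_lift _ _)) mul1r big1 ?addr0 // => l neq_l.
  by rewrite !mxE eq_sym (negPf (neq_lift _ _)) eq_sym (negPf neq_l) mul0r.
have -> : gram_det dot w = \det (L *m G) by rewrite det_mulmx detL mul1r.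
rewrite (expand_det_row _ ord_max) (bigD1_ord ord_max) //=.
rewrite big1 ?addr0; last by move=> i _; rewrite LG_max w_lift orth mul0r.
rewrite LG_max w_max sqr_ip_norm; congr (_ * _).
  (* The corner entry is <z, x>, which equals <z, z> because x - z lies in the span. *)
  by rewrite [in RHS]/z linearBr /= dot_sum_eq0 // subr0.
rewrite /cofactor -signr_odd addnn odd_double mul1r; congr (\det _).
by apply/matrixP => i j; rewrite 2!mxE LG_lift w_lift mxE.
Qed.

(** By induction, splitting off the last vector multiplies the determinant by the squared norm of
    its residual over the others. *)
Lemma gram_det_ge0 (n : nat) (v : 'I_n -> H) :
  linearly_independent v -> 0 <= gram_det dot v.
Proof.
elim: n v => [v _|n IHn v v_free]; first by rewrite /gram_det det_mx00.
pose u i := v (lift ord_max i).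
have u_free : linearly_independent u.
  move=> c cu0 i.
  (* A relation among the first n vectors is padded with coefficient 0 on the last one. *)
  pose e j := if unlift ord_max j is Some l then c l else 0.
  have := v_free e _ (lift ord_max i); rewrite /e liftK; apply.
  rewrite (bigD1_ord ord_max) //= unlift_none scale0r add0r -[RHS]cu0.
  by apply: eq_bigr => j _; rewrite liftK.
have -> : gram_det dot v = gram_det dot (append_vector u (v ord_max)).
  have vE i : append_vector u (v ord_max) i = v i.
    by rewrite /append_vector; case: unliftP => [j ->|->].
  by congr (\det _); apply/matrixP => i j; rewrite !mxE !vE.
have [c orth] := orthogonal_projection (v ord_max) u_free.
rewrite (gram_det_append_vector orth) mulr_ge0 ?IHn //.
by rewrite sqr_ip_norm dot_ge0.
Qed.

End Gram.

Theorem theorem3 (R : realType) (k : scalar_kind) (H : lmodType (scalars R k))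
    (dot : {dot H for @scalar_conj R k}) (n : nat) (v : 'I_n -> H) (x : H)
    (v_free : linearly_independent v)
    (x_notin : ~ orthogonal_complement dot (linear_span v) x) :
  ip_dist dot x (linear_span v) ^+ 2 <=
    (ip_norm dot x ^+ 2
       * (max_sqnorm dot v + (n%:R - 1) * max_offdiag dot v)
     - \sum_(i < n) scalar_abs (dot x (v i)) ^+ 2)
    / (max_sqnorm dot v + (n%:R - 1) * max_offdiag dot v)
  /\
  gram_det dot (append_vector v x) <=
    scalar_of_real k
      ((ip_norm dot x ^+ 2
          * (max_sqnorm dot v + (n%:R - 1) * max_offdiag dot v)
        - \sum_(i < n) scalar_abs (dot x (v i)) ^+ 2)
       / (max_sqnorm dot v + (n%:R - 1) * max_offdiag dot v))
    * gram_det dot v.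
Proof.
(* For [n = 0] the span is {0} and its complement is all of H, contrary to [x_notin]. Positivity of
   n makes [n%:R - 1] nonnegative and the bracket positive. *)
have n_gt0 : (0 < n)%N.
  rewrite lt0n; apply: contra_notN x_notin => /eqP n0 _ [c ->].
  by rewrite dot_sum_eq0 // => i; have := ltn_ord i; rewrite [ltnRHS]n0.
have B_gt0 : 0 < max_sqnorm dot v + (n%:R - 1) * max_offdiag dot v.
  rewrite ltr_wpDr ?max_sqnorm_gt0 // mulr_ge0 ?max_offdiag_ge0 //.
  by rewrite subr_ge0 ler1n.
have le_bessel := sqr_ip_norm_sub_bessel_sum x B_gt0.
split.
  apply: le_trans le_bessel; set y := \sum_i _.
  (* The lower bound 0 puts the infimum below each value of the set and makes it nonnegative, so
     that the comparison may be squared. *)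
  have lb0 : lbound [set ip_norm dot (x - u) | u in linear_span v]%classic 0.
    by move=> _ [u _ <-]; exact: ip_norm_ge0.
  have ym : [set ip_norm dot (x - u) | u in linear_span v]%classic
      (ip_norm dot (x - y)).
    by exists y => //; eexists.
  rewrite lerXn2r ?nnegrE ?ip_norm_ge0 //.
    by apply: lb_le_inf => //; exists (ip_norm dot (x - y)).
  by apply: ge_inf => //; exists 0.
have [c orth] := orthogonal_projection dot x v_free.
rewrite (gram_det_append_vector orth) ler_wpM2r ?gram_det_ge0 //.
rewrite scalar_of_real_le; apply: le_trans le_bessel.
exact: sqr_ip_norm_projection_min.
Qed.
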